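(* Let $\mathcal L$ be a logic. The following conditions are equivalent: (i) The truth sets of $\mathcal L$ are almost parametrically equationally definable, i.e. there is a parametrized equational translation $\tau(x,\vec y)$ such that $\tau(\mathbf A)=F$ for every $\langle \mathbf A,F\rangle\in \mathrm{Mod}^{*}\mathcal L$ with $F\neq\emptyset$. (ii) For every algebra $\mathbf A$, the Leibniz operator $\Omega^{\mathbf A}$ is almost completely order-reflecting over $\mathcal{F}i_{\mathcal L}\mathbf A$. (iii) The Leibniz operator $\Omega\colon \mathrm{Th}\mathcal L\to \mathrm{Con}\,\mathbf{Fm}$ is almost completely order-reflecting. Moreover, in this case the parametrized equational translation $\tau(x,\vec y):=\widetilde{\Omega}_{\mathcal L}\, C_{\mathcal L}\{x\}$ (the Suszko congruence of the theory $C_{\mathcal L}\{x\}$ on $\mathbf{Fm}$, viewed as a set of equations, with $\vec y$ the list of all variables different from $x$) satisfies $\tau(\mathbf A)=F$ for every $\langle \mathbf A,F\rangle\in\mathrm{Mod}^{*}\mathcal L$ with $F\neq\emptyset$.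
   Context: Fix an algebraic type and a countably infinite set of variables; $Fm$ is the set of formulas and $\mathbf{Fm}$ the formula (term) algebra; an equation is a pair of formulas, written $\varepsilon\approx\delta$. A logic $\mathcal L$ is a closure operator $C_{\mathcal L}$ on $\mathcal P(Fm)$ which is structural: $\sigma[C_{\mathcal L}(\Gamma)]\subseteq C_{\mathcal L}(\sigma[\Gamma])$ for every substitution $\sigma$; write $\Gamma\vdash_{\mathcal L}\varphi$ for $\varphi\in C_{\mathcal L}(\Gamma)$. A deductive filter of $\mathcal L$ over an algebra $\mathbf A$ is a set $F\subseteq A$ such that whenever $\Gamma\vdash_{\mathcal L}\varphi$ and $h\colon\mathbf{Fm}\to\mathbf A$ is a homomorphism with $h[\Gamma]\subseteq F$, then $h(\varphi)\in F$; $\mathcal{F}i_{\mathcal L}\mathbf A$ is the set of these filters, and $\mathrm{Th}\mathcal L=\mathcal{F}i_{\mathcal L}\mathbf{Fm}$ (theories). For $F\subseteq A$, the Leibniz congruence $\Omega^{\mathbf A}F$ is the largest congruence $\theta$ of $\mathbf A$ compatible with $F$ (i.e. $\langle a,b\rangle\in\theta$ and $a\in F$ imply $b\in F$); $\Omega:=\Omega^{\mathbf{Fm}}$. The Suszko congruence is $\widetilde\Omega^{\mathbf A}_{\mathcal L}F:=\bigcap\{\Omega^{\mathbf A}G: G\in\mathcal{F}i_{\mathcal L}\mathbf A,\ F\subseteq G\}$, and $\widetilde\Omega_{\mathcal L}:=\widetilde\Omega^{\mathbf{Fm}}_{\mathcal L}$. A matrix is a pair $\langle\mathbf A,F\rangle$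 with $F\subseteq A$; $\mathrm{Mod}^{*}\mathcal L:=\{\langle\mathbf A,F\rangle: F\in\mathcal{F}i_{\mathcal L}\mathbf A,\ \Omega^{\mathbf A}F=\mathrm{Id}_{\mathbf A}\}$. A parametrized equational translation is a set $\tau(x,\vec y)$ of equations in a distinguished variable $x$ and parameter variables $\vec y$ (possibly infinitely many); for an algebra $\mathbf A$, $\tau(\mathbf A):=\{a\in A: \mathbf A\models\tau(a,\vec c)\text{ for every assignment }\vec c\text{ of elements of }A\text{ to the parameters}\}$. A map $\Omega^{\mathbf A}$ is almost completely order-reflecting over $\mathcal{F}i_{\mathcal L}\mathbf A$ if for every family $\mathcal F\cup\{G\}$ of non-empty filters in $\mathcal{F}i_{\mathcal L}\mathbf A$, $\bigcap_{F\in\mathcal F}\Omega^{\mathbf A}F\subseteq\Omega^{\mathbf A}G$ implies $\bigcap\mathcal F\subseteq G$ (empty intersections being $A\times A$ and $A$ respectively). *)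

(* Defs.v *)
From mathcomp Require Import all_boot.
From mathcomp Require Import boolp classical_sets functions cardinality.
From Stdlib Require Import Relation_Operators.

Set Implicit Arguments.
Unset Strict Implicit.
Unset Printing Implicit Defensive.

Local Open Scope classical_set_scope.

Record signature := Signature {
  symbol : Type;
  arity : symbol -> nat
}.

(* Algebras with empty carrier are not excluded. They have no non-empty
   filters, hence are irrelevant to every notion defined below. *)
Record algebra (S : signature) := Algebra {
  carrier :> Type;
  interp : forall f : symbol S, ('I_(arity f) -> carrier) -> carrier
}.
Arguments interp {S} A f args : rename.

Definition homomorphism (S : signature) (A B : algebra S) (h : A -> B) : Prop :=
  forall (f : symbol S) (a : 'I_(arity f) -> A),
    h (interp A f a) = interp B f (fun i => h (a i)).

Inductive formula (S : signature) (V : Type) : Type :=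
| Var (x : V)
| App (f : symbol S) (args : 'I_(arity f) -> formula S V).
Arguments Var {S V} x.
Arguments App {S V} f args.

Definition Fm (S : signature) (V : Type) : algebra S :=
  @Algebra S (formula S V) (@App S V).

Fixpoint eval (S : signature) (V : Type) (A : algebra S) (v : V -> A)
    (t : formula S V) : A :=
  match t with
  | Var x => v x
  | App f args => interp A f (fun i => eval v (args i))
  end.

Definition equation (S : signature) (V : Type) : Type :=
  (Fm S V * Fm S V)%type.

Record logic (S : signature) (V : Type) := Logic {
  cn :> set (Fm S V) -> set (Fm S V);
  cn_extensive : forall G, G `<=` cn G;
  cn_monotone : forall G D, G `<=` D -> cn G `<=` cn D;
  cn_idempotent : forall G, cn (cn G) = cn G;
  cn_structural : forall s : Fm S V -> Fm S V, homomorphism s ->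
    forall G, s @` cn G `<=` cn (s @` G)
}.

Section Congruences.
Variables (S : signature) (A : algebra S).

Record congruence (th : set (A * A)) : Prop := Congruence {
  congr_refl : forall a, th (a, a);
  congr_sym : forall a b, th (a, b) -> th (b, a);
  congr_trans : forall a b c, th (a, b) -> th (b, c) -> th (a, c);
  congr_interp : forall (f : symbol S) (a b : 'I_(arity f) -> A),
    (forall i, th (a i, b i)) -> th (interp A f a, interp A f b)
}.

Definition compatible (th : set (A * A)) (F : set A) : Prop :=
  forall a b, th (a, b) -> F a -> F b.

(* The union of all compatible congruences; [leibniz_largest] below shows that
   it is itself one, i.e. the largest. *)
Definition leibniz (F : set A) : set (A * A) :=
  \bigcup_(th in [set th | congruence th /\ compatible th F]) th.

Let chain (F : set A) : A -> A -> Prop :=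
  clos_refl_trans A (fun a b => leibniz F (a, b)).

Let chain_compatible F a b : chain F a b -> F a -> F b.
Proof.
elim=> {a b} [a b [th [_ cth] thab]|//|a b c _ ab _ bc /ab/bc//].
exact: cth thab.
Qed.

Let chain_sym F a b : chain F a b -> chain F b a.
Proof.
elim=> {a b} [a b [th [cth fth] thab]|a|a b c _ ba _ cb].
- by apply: rt_step; exists th => //; apply: congr_sym thab.
- exact: rt_refl.
- exact: rt_trans cb ba.
Qed.

Let upd n (u : 'I_n -> A) (k : nat) (c : A) : 'I_n -> A :=
  fun i => if i == k :> nat then c else u i.

Let chain_upd F (f : symbol S) (u : 'I_(arity f) -> A) k a b :
  chain F a b -> chain F (interp A f (upd u k a)) (interp A f (upd u k b)).
Proof.
elim=> {a b} [a b [th [cth fth] thab]|a|a b c _ ab _ bc].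
- apply: rt_step; exists th => //; apply: (congr_interp cth) => i.
  by rewrite /upd; case: ifP => // _; apply: congr_refl cth _.
- exact: rt_refl.
- exact: rt_trans ab bc.
Qed.

Let chain_interp F (f : symbol S) (a b : 'I_(arity f) -> A) :
  (forall i, chain F (a i) (b i)) -> chain F (interp A f a) (interp A f b).
Proof.
move=> ab; pose w k : 'I_(arity f) -> A := fun i => if i < k then b i else a i.
have step k : chain F (interp A f a) (interp A f (w k)).
  elim: k => [|k IHk].
    by rewrite (_ : w 0 = a); [exact: rt_refl|exact/funext].
  apply: rt_trans IHk _.
  have [kf|kf] := ltnP k (arity f).
    have -> : w k = upd (w k) k (a (Ordinal kf)).
      apply/funext => i; rewrite /upd /w; case: eqP => // ik.
      by rewrite ik ltnn; congr a; apply: val_inj.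
    have -> : w k.+1 = upd (w k) k (b (Ordinal kf)).
      apply/funext => i; rewrite /upd /w ltnS leq_eqVlt.
      case: eqP => //= ik; congr b; exact: val_inj.
    exact: chain_upd.
  rewrite (_ : w k.+1 = w k); first exact: rt_refl.
  apply/funext => i; rewrite /w.
  have ik := leq_trans (ltn_ord i) kf.
  by rewrite ik ltnS ltnW.
rewrite (_ : b = w (arity f)); first exact: step.
by apply/funext => i; rewrite /w ltn_ord.
Qed.

Lemma leibniz_largest (F : set A) :
  [/\ congruence (leibniz F), compatible (leibniz F) F &
      forall th, congruence th -> compatible th F -> th `<=` leibniz F].
Proof.
have le th : congruence th -> compatible th F -> th `<=` leibniz F.
  by move=> cth fth p thp; exists th.
have cc : congruence [set p | chain F p.1 p.2].
  split=> /=.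
  - by move=> a; apply: rt_refl.
  - by move=> a b; apply: chain_sym.
  - by move=> a b c; apply: rt_trans.
  - by move=> f a b; apply: chain_interp.
have fc : compatible [set p | chain F p.1 p.2] F.
  by move=> a b /=; apply: chain_compatible.
have E : leibniz F = [set p | chain F p.1 p.2].
  rewrite eqEsubset; split; last exact: le.
  by move=> [a b] ab; apply: rt_step.
by split=> //; rewrite E.
Qed.

End Congruences.

Section Filters.
Variables (S : signature) (V : Type) (L : logic S V).

Definition filters (A : algebra S) : set (set A) :=
  [set F | forall (G : set (Fm S V)) (phi : Fm S V), L G phi ->
     forall h : Fm S V -> A, homomorphism h -> h @` G `<=` F -> F (h phi)].

Definition theories : set (set (carrier (Fm S V))) := @filters (Fm S V).

Definition suszko (A : algebra S) (F : set A) : set (A * A) :=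
  \bigcap_(G in [set G | filters G /\ F `<=` G]) leibniz G.

(* [Modstar A F] says that the matrix <A, F> belongs to Mod^* L. *)
Definition Modstar (A : algebra S) (F : set A) : Prop :=
  filters F /\ leibniz F = [set p | p.1 = p.2].

End Filters.

Arguments filters {S V} L A.
Arguments suszko {S V} L A F.

(* The parameters are all the variables other than [dvar]; those that do not
   occur in [eqns] play no role. *)
Record translation (S : signature) (V : Type) := Translation {
  dvar : V;
  eqns : set (equation S V)
}.

Definition solutions (S : signature) (V : Type) (tau : translation S V)
    (A : algebra S) : set A :=
  [set a | forall v : V -> A, v (dvar tau) = a ->
     forall e, eqns tau e -> eval v e.1 = eval v e.2].
Arguments solutions {S V} tau A.

Definition defines_nonempty_truth_sets (S : signature) (V : Type)
    (L : logic S V) (tau : translation S V) : Prop :=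
  forall (A : algebra S) (F : set A),
    Modstar L F -> F !=set0 -> solutions tau A = F.

(* An intersection over the empty family is the full set. *)
Definition almost_completely_order_reflecting (T U : Type)
    (Om : set T -> set U) (Fi : set (set T)) : Prop :=
  forall (Fs : set (set T)) (G : set T),
    (forall F, Fs F -> Fi F /\ F !=set0) -> Fi G -> G !=set0 ->
    \bigcap_(F in Fs) Om F `<=` Om G -> \bigcap_(F in Fs) F `<=` G.

Definition suszko_translation (S : signature) (V : Type) (L : logic S V)
    (x : V) : translation S V :=
  Translation x (suszko L (Fm S V) (L [set Var x])).

(* Main.v *)
(** Write [x] for the distinguished variable and [tau] for the Suszko congruence
    of [C{x}].

    If [tau'] defines the non-empty truth sets, then passing to the quotient by
    [Omega F] shows that membership in a non-empty filter [F] is the inclusion of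
    all instances of [tau'] in [Omega F]; such a condition is inherited along
    [bigcap Omega F <= Omega G].

    Conversely, let [<A, F>] be reduced. If [a] solves [tau] and [h] maps [x] to
    [a] and the other variables into [F], then [tau <= ker h <= Omega (h^-1 F)],
    so order reflection on theories, applied to the theories containing [x],
    puts [x] in [h^-1 F]. If [a] is in [F] and [(phi, psi)] is in [tau], the
    finitely many variables of [phi] and [psi] leave enough fresh ones to name
    the parameters of any unary polynomial of [A]; hence no such polynomial
    separates [h phi] from [h psi] with respect to [F], so that
    [(h phi, h psi)] lies in [Omega F], which is the identity. *)
Require Import Defs.
From mathcomp Require Import all_boot.
From mathcomp Require Import boolp classical_sets functions cardinality.

Set Implicit Arguments.
Unset Strict Implicit.
Unset Printing Implicit Defensive.

Local Open Scope classical_set_scope.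
Local Open Scope card_scope.

(** * Evaluation, homomorphisms and congruences *)

Lemma eval_hom (S : signature) (V : Type) (A : algebra S) (v : V -> A) :
  homomorphism (eval v : Fm S V -> A).
Proof. by []. Qed.

Lemma hom_eval (S : signature) (V : Type) (A B : algebra S) (h : A -> B)
    (v : V -> A) (t : formula S V) :
  homomorphism h -> h (eval v t) = eval (h \o v) t.
Proof.
move=> hh; elim: t => [//|f args IH] /=.
by rewrite hh; congr (interp B f _); apply/funext.
Qed.

Lemma hom_Fm_eval (S : signature) (V : Type) (A : algebra S) (h : Fm S V -> A) :
  homomorphism h -> h = eval (h \o Var).
Proof.
move=> hh; apply/funext; elim=> [//|f args IH] /=.
by rewrite -[App f args]/(interp (Fm S V) f args) hh; congr (interp A f _); apply/funext.
Qed.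

Lemma hom_comp (S : signature) (A B C : algebra S) (g : B -> C) (h : A -> B) :
  homomorphism g -> homomorphism h -> homomorphism (g \o h).
Proof. by move=> hg hh f a /=; rewrite hh hg. Qed.

Lemma eval_congr (S : signature) (V : Type) (A : algebra S) (th : set (A * A))
    (v w : V -> A) (t : formula S V) :
  congruence th -> (forall x, th (v x, w x)) -> th (eval v t, eval w t).
Proof. by move=> cth vw; elim: t => [//|f args IH]; apply: congr_interp. Qed.

Lemma preimage_congruence (S : signature) (A B : algebra S) (h : A -> B)
    (th : set (B * B)) :
  homomorphism h -> congruence th -> congruence [set p | th (h p.1, h p.2)].
Proof.
move=> hh [r s t c]; split=> /=; first by move=> a; apply: r.
- by move=> a b; apply: s.
- by move=> a b d; apply: t.
- by move=> f a b ab; rewrite !hh; apply: c.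
Qed.

Lemma eq_congruence (S : signature) (A : algebra S) :
  congruence [set p : A * A | p.1 = p.2].
Proof.
split=> //= [a b c -> //|f a b ab].
by congr (interp A f _); apply/funext.
Qed.

Lemma preimage_filter (S : signature) (V : Type) (L : logic S V)
    (A B : algebra S) (h : A -> B) (F : set B) :
  homomorphism h -> filters L B F -> filters L A (h @^-1` F).
Proof.
move=> hh FF G phi Gphi k hk kG; apply: (FF _ _ Gphi (h \o k)).
  exact: hom_comp.
by move=> _ [g Gg <-]; apply: kG; exists g.
Qed.

Lemma ker_leibniz (S : signature) (A B : algebra S) (h : A -> B) (F : set B) :
  homomorphism h ->
  [set p | h p.1 = h p.2] `<=` leibniz (h @^-1` F).
Proof.
move=> hh; have [_ _ largest] := leibniz_largest (h @^-1` F).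
apply: largest; first exact: (preimage_congruence hh (eq_congruence B)).
by move=> a b /= ->.
Qed.

(** * Quotients and reduced matrices *)

Lemma quotient_algebra (S : signature) (A : algebra S) (th : set (A * A)) :
  congruence th ->
  exists (B : algebra S) (q : A -> B) (s : B -> A),
    [/\ homomorphism q, cancel s q & forall a b, q a = q b <-> th (a, b)].
Proof.
move=> cth; have [rfl sym trans cong] := cth.
pose cls a : set A := [set b | th (a, b)].
pose B := {X : set A | exists a, X = cls a}.
pose q a : B := exist _ (cls a) (ex_intro _ a erefl).
have qE a b : q a = q b <-> th (a, b).
  split=> [/(congr1 sval)/= E|ab].
    by rewrite -[th _]/(cls a b) E; apply: rfl.
  rewrite /q; apply: eq_exist; apply/seteqP; split=> c /= ?.
    exact: trans (sym _ _ ab) _.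
  exact: trans ab _.
(* A choice of representatives; the operations of the quotient are computed on them. *)
pose s (X : B) : A := projT1 (cid (svalP X)).
have sK : cancel s q.
  by move=> [X clsX]; rewrite /q; apply: eq_exist; rewrite /s; case: cid => a.
exists (@Algebra S B (fun f args => q (interp A f (s \o args)))), q, s.
split=> // f a; apply/qE; apply: cong => i; apply/qE.
by rewrite [in RHS]/comp sK.
Qed.

Section Quotient.
Context {S : signature} {V : Type} (L : logic S V) {A B : algebra S}.
Context {F : set A} {q : A -> B} {s : B -> A}.
Hypotheses (hq : homomorphism q) (sK : cancel s q).
Hypothesis qE : forall a b, q a = q b <-> leibniz F (a, b).

Lemma quotient_memE a : (q @` F) (q a) <-> F a.
Proof.
split=> [[b Fb /qE ba]|Fa]; last by exists a.
by have [_ + _] := leibniz_largest F; apply; first exact: ba.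
Qed.

Lemma quotient_Modstar : filters L A F -> Modstar L (q @` F).
Proof.
move=> FF; split.
  move=> G phi Gphi h hh hG; rewrite (hom_Fm_eval hh).
  (* A homomorphism from formulas into the quotient lifts along [q]: pick representatives of the
     values of the variables. *)
  have -> : h \o Var = q \o (s \o h \o Var) by apply/funext => y /=; rewrite sK.
  rewrite -hom_eval //; apply/quotient_memE.
  apply: (FF _ _ Gphi); first exact: eval_hom.
  move=> _ [g Gg <-]; apply/quotient_memE; rewrite hom_eval //.
  have -> : q \o (s \o h \o Var) = h \o Var by apply/funext => y /=; rewrite sK.
  by rewrite -(hom_Fm_eval hh); apply: hG; exists g.
have [cB compB _] := leibniz_largest (q @` F).
apply/seteqP; split=> -[a b] /=; last by move=> ->; apply: congr_refl cB _.
rewrite -(sK a) -(sK b); set a' := s a; set b' := s b => ab.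
apply/qE; have [_ _ largest] := leibniz_largest F.
apply: (largest _ (preimage_congruence hq cB)) => // c d /= cd Fc.
by apply/quotient_memE; apply: compB cd _; apply/quotient_memE.
Qed.

End Quotient.

Lemma filter_mem_translation (S : signature) (V : Type) (L : logic S V)
    (tau : translation S V) (A : algebra S) (F : set A) (a : A) :
  defines_nonempty_truth_sets L tau -> filters L A F -> F !=set0 ->
  F a <-> forall v : V -> A, v (dvar tau) = a ->
            forall e, eqns tau e -> leibniz F (eval v e.1, eval v e.2).
Proof.
move=> dtau FF [c Fc]; have [cF _ _] := leibniz_largest F.
have [B [q [s [hq sK qE]]]] := quotient_algebra cF.
have solE : solutions tau B = q @` F.
  by apply: dtau; [exact: quotient_Modstar sK qE FF|exists (q c), c].
rewrite -(quotient_memE qE) -solE; split=> [sol v vx e taue|leib w wx e taue].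
  apply/qE; rewrite !hom_eval //; apply: sol => //=.
  by rewrite vx.
(* The lift of [w] through [s] must send the distinguished variable to [a] itself, which may differ
   from [s (q a)]. *)
pose v y := if asbool (y = dvar tau) then a else s (w y).
have -> : w = q \o v.
  by apply/funext => y; rewrite /v /=; case: asboolP => [->|_]; rewrite ?sK.
rewrite -!hom_eval //; apply/qE; apply: leib => //.
by rewrite /v; case: asboolP.
Qed.

Lemma definable_order_reflecting (S : signature) (V : Type) (L : logic S V)
    (tau : translation S V) (A : algebra S) :
  defines_nonempty_truth_sets L tau ->
  almost_completely_order_reflecting (@leibniz S A) (filters L A).
Proof.
move=> dtau Fs G FsF FG G0 sub a Fsa.
apply/(filter_mem_translation _ dtau FG G0) => v vx e taue.
apply: sub => F FsF'; have [FF F0] := FsF _ FsF'.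
by apply: (filter_mem_translation a dtau FF F0).1 => //; apply: Fsa.
Qed.

(** * Unary polynomials and the Leibniz congruence *)

Section PolynomialEquivalence.
Context {S : signature} {A : algebra S}.

(** [None] is the hole and [Some c] a parameter, so formulas over [option P] act as unary
    polynomials. *)
Definition poly_eval (P : Type) (p : P -> A) (a : A) : formula S (option P) -> A :=
  eval (fun o => if o is Some c then p c else a).

(* The parameters are indexed by a countable type, rather than being elements
   of [A], so that they can later be named by variables even if [A] is
   uncountable. *)
Definition poly_equiv (F : set A) : set (A * A) :=
  [set ab | forall (P : countType) (p : P -> A) (d : formula S (option P)),
    F (poly_eval p ab.1 d) <-> F (poly_eval p ab.2 d)].

Definition update {n} (u : 'I_n -> A) (j : 'I_n) (c : A) : 'I_n -> A :=
  fun i => if i == j then c else u i.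

(** Plugging [f] into the hole of [d] turns its other arguments into additional parameters. *)
Lemma poly_eval_update (P : Type) (p : P -> A) (f : symbol S)
    (u : 'I_(arity f) -> A) (j : 'I_(arity f)) (d : formula S (option P)) :
  exists d' : formula S (option ('I_(arity f) + P)), forall a,
    poly_eval p (interp A f (update u j a)) d =
    poly_eval (fun c => match c with inl i => u i | inr c => p c end) a d'.
Proof.
pose sub (o : option P) : Fm S (option ('I_(arity f) + P)) :=
  if o is Some c then Var (Some (inr c))
  else App f (fun i => Var (if i == j then None else Some (inl i))).
exists (eval sub d) => a; rewrite /poly_eval hom_eval; last exact: eval_hom.
congr (eval _ d); apply/funext => -[c|] //=.
by congr (interp A f _); apply/funext => i; rewrite /update; case: eqP.
Qed.

Lemma poly_equiv_interp (F : set A) (f : symbol S) (a b : 'I_(arity f) -> A) :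
  (forall i, poly_equiv F (a i, b i)) ->
  poly_equiv F (interp A f a, interp A f b).
Proof.
move=> ab P p d /=.
(* Arguments are exchanged one at a time; past the arity [w] is stationary. *)
pose w k : 'I_(arity f) -> A := fun i => if i < k then b i else a i.
have -> : b = w (arity f) by apply/funext => i; rewrite /w ltn_ord.
elim: {1}(arity f) => [|k ->]; first by rewrite (_ : w 0 = a) //; apply/funext.
have [kf|kf] := ltnP k (arity f); last first.
  rewrite (_ : w k.+1 = w k) //; apply/funext => i.
  by rewrite /w (leq_trans (ltn_ord i) kf) ltnS ltnW // (leq_trans (ltn_ord i)).
pose j := Ordinal kf.
have -> : w k = update (w k) j (a j).
  by apply/funext => i; rewrite /update /w; case: eqP => // ->; rewrite ltnn.
have -> : w k.+1 = update (w k) j (b j).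
  apply/funext => i; rewrite /update /w ltnS leq_eqVlt -[(i : nat) == k]/(i == j).
  by case: eqP => // ->.
by have [d' d'E] := poly_eval_update p (w k) j d; rewrite !d'E; apply: ab.
Qed.

Lemma poly_equiv_leibniz (F : set A) : poly_equiv F `<=` leibniz F.
Proof.
have [_ _ largest] := leibniz_largest F; apply: largest.
  split=> //.
  - by move=> a b ab P p d; rewrite ab.
  - by move=> a b c ab bc P p d; rewrite ab bc.
  - exact: poly_equiv_interp.
(* The bare hole, a polynomial without parameters, yields compatibility. *)
by move=> a b /(_ void (@of_void A) (Var None)) [].
Qed.

End PolynomialEquivalence.

(** * Definability by the Suszko translation *)

Lemma eval_bounded_support (S : signature) (V : Type) (A : algebra S)
    (rank : V -> nat) (t : formula S V) :
  exists N, forall v w : V -> A,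
    (forall y, rank y < N -> v y = w y) -> eval v t = eval w t.
Proof.
elim: t => [x|f args]; first by exists (rank x).+1 => v w /(_ x (leqnn _)).
move=> /choice[N NP]; exists (\max_i N i) => v w vw /=.
congr (interp A f _); apply/funext => i; apply: NP => y yN; apply: vw.
exact: leq_trans yN (leq_bigmax i).
Qed.

Lemma suszko_eval_leibniz (S : signature) (V : Type) (L : logic S V)
    (e : nat -> V) (rank : V -> nat) (eK : cancel e rank)
    (A : algebra S) (F : set A) (v : V -> A) (x : V) (phi psi : Fm S V) :
  filters L A F -> F (v x) -> suszko L (Fm S V) (L [set Var x]) (phi, psi) ->
  leibniz F (eval v phi, eval v psi).
Proof.
move=> FF Fvx phipsi; apply: poly_equiv_leibniz => P p d /=.
have [N1 N1P] := eval_bounded_support A rank phi.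
have [N2 N2P] := eval_bounded_support A rank psi.
(* The values of [x], [phi] and [psi] depend only on variables of rank below [N]. *)
pose N := maxn (rank x).+1 (maxn N1 N2).
(* From rank [N] on, variables name the parameters through their codes; where decoding fails, [v] is
   kept. *)
pose v' y := if rank y < N then v y
             else if unpickle (rank y - N) is Some c then p c else v y.
have v'E y : rank y < N -> v y = v' y by rewrite /v' => ->.
have v'phi : eval v' phi = eval v phi.
  by apply/esym/N1P => y yN; apply: v'E; rewrite !leq_max yN orbT.
have v'psi : eval v' psi = eval v psi.
  by apply/esym/N2P => y yN; apply: v'E; rewrite !leq_max yN !orbT.
pose fresh (c : P) := e (N + pickle c).
have v'fresh c : v' (fresh c) = p c.
  by rewrite /v' /fresh eK ltnNge leq_addr /= addKn pickleK.
(* [T] is a theory containing [C{x}], so [(phi, psi)] lies in its Leibniz congruence. *)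
pose T : set (Fm S V) := eval v' @^-1` F.
have FT : filters L (Fm S V) T := preimage_filter (eval_hom v') FF.
have Tx : L [set Var x] `<=` T.
  move=> t Lt; apply: (FT _ _ Lt idfun) => // _ [_ -> <-]; rewrite /T /=.
  by rewrite -v'E // leq_max leqnn.
have [cT compT _] := leibniz_largest T.
have TE := phipsi _ (conj FT Tx).
pose inst (chi : Fm S V) : Fm S V :=
  poly_eval (fun c => Var (fresh c) : Fm S V) chi d.
have instE chi : eval v' (inst chi) = poly_eval p (eval v' chi) d.
  rewrite /inst /poly_eval (hom_eval _ _ (eval_hom v')).
  by congr (eval _ d); apply/funext => -[c|] //=; rewrite v'fresh.
have inst_leibniz : leibniz T (inst phi, inst psi).
  by apply: eval_congr => // -[c|] //; apply: congr_refl cT _.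
rewrite -v'phi -v'psi -!instE; split; first exact: compT inst_leibniz.
exact/compT/(congr_sym cT).
Qed.

Lemma order_reflecting_suszko_translation (S : signature) (V : Type)
    (L : logic S V) (e : nat -> V) (rank : V -> nat) (x : V) :
  cancel e rank ->
  almost_completely_order_reflecting (@leibniz S (Fm S V)) (theories L) ->
  defines_nonempty_truth_sets L (suszko_translation L x).
Proof.
move=> eK refl A F [FF redF] [b Fb]; apply/seteqP; split=> a.
- move=> sol; pose v y := if asbool (y = x) then a else b.
  have vx : v x = a by rewrite /v; case: asboolP.
  (* A second variable exists since [e] is injective; sent to [b], it makes [T] non-empty. *)
  have [y yx] : exists y, y <> x.
    apply: contrapT => nex.
    have ex n : e n = x by apply: contrapT => ?; apply: nex; exists (e n).
    by have /(can_inj eK) := etrans (ex 0) (esym (ex 1)).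
  have vy : v y = b by rewrite /v; case: asboolP.
  pose T : set (Fm S V) := eval v @^-1` F.
  have FT : theories L T := preimage_filter (eval_hom v) FF.
  have TVar t : L [set Var x] `<=` t -> t (Var x) by apply; apply: cn_extensive.
  suff : T (Var x) by rewrite /T /= vx.
  (* The Leibniz congruences of this family meet exactly in the Suszko congruence of [C{x}], whose
     pairs [v] equalises because [a] is a solution. *)
  apply: (refl [set G | filters L (Fm S V) G /\ L [set Var x] `<=` G] T) => //.
  + by move=> G [FG xG]; split=> //; exists (Var x); apply: TVar.
  + by exists (Var y); rewrite /T /= vy.
  + by move=> p taup; apply: (ker_leibniz F (eval_hom v)); apply: sol taup.
  + by move=> G [_ xG]; apply: TVar.
- move=> Fa v vx [phi psi] taue.
  have : leibniz F (eval v phi, eval v psi).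
    by apply: (suszko_eval_leibniz eK FF (x := x)) => //; rewrite vx.
  by rewrite redF.
Qed.

Theorem theorem3p9 (S : signature) (V : Type)
    (V_countably_infinite : [set: V] #= [set: nat]) (L : logic S V) :
  let cond_i := exists tau : translation S V,
    defines_nonempty_truth_sets L tau in
  let cond_ii := forall A : algebra S,
    almost_completely_order_reflecting (@leibniz S A) (filters L A) in
  let cond_iii :=
    almost_completely_order_reflecting (@leibniz S (Fm S V)) (theories L) in
  (cond_i <-> cond_ii) /\ (cond_ii <-> cond_iii) /\
  (cond_i ->
     forall x : V, defines_nonempty_truth_sets L (suszko_translation L x)).
Proof.
move=> cond_i cond_ii cond_iii.
have [e [rank eK]] : exists (e : nat -> V) (rank : V -> nat), cancel e rank.
  have /card_set_bijP[rank [_ _ surj]] := V_countably_infinite.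
  have /choice[e eK] n : exists y, rank y = n by have [y] := surj n I; exists y.
  by exists e, rank.
have i_ii : cond_i -> cond_ii.
  by move=> [tau dtau] A; apply: definable_order_reflecting dtau.
have ii_iii : cond_ii -> cond_iii by apply.
have iii_tau : cond_iii -> forall x, defines_nonempty_truth_sets L (suszko_translation L x).
  by move=> c x; apply: order_reflecting_suszko_translation eK c.
have iii_i : cond_iii -> cond_i.
  by move=> c; exists (suszko_translation L (e 0)); apply: iii_tau.
split; first by split=> // /ii_iii.
split; first by split=> // /iii_i.
by move=> /i_ii/ii_iii/iii_tau.
Qed.
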